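(* Every $p$-comparability graph $G$ is ESP.
   Context: All graphs are finite and simple. $p$-comparability graphs. Let $D$ be a (finite) digraph with a special set $T$ of vertices such that every arc of $D$ is in a dicycle (directed cycle) and every dicycle of $D$ meets $T$ in exactly one vertex (in particular, $D$ has no arc between two vertices of $T$). If $p$ is an integer with $|T|\le p$, then a $p$-comparability graph $G$ is defined from $D$ by adding all chords of all dicycles of $D$ (so that any two distinct vertices lying on a common dicycle of $D$ become adjacent), then deleting $T$, and finally ignoring all directions on edges. ESP graphs. For a multiset $\Lambda$ of cliques of $G$ and $v\in V(G)$, $d_\Lambda(v)$ denotes the number of members of $\Lambda$ (with multiplicity) that contain $v$. A graph $G=(V,E)$ is equitably subpartitionable (ESP) if for every set $\Lambda$ of (inclusionwise) maximal cliques of $G$ there exist two multisets $\Lambda_1,\Lambda_2$ of cliques of $G$ (not necessarily members of $\Lambda$) such that (i) $|\Lambda_1|+|\Lambda_2|\le|\Lambda|$; (ii) $d_{\Lambda_1}(v)+d_{\Lambda_2}(v)\ge d_\Lambda(v)$ for all $v\in V$; (iii) $\min\{d_{\Lambda_1}(v),d_{\Lambda_2}(v)\}\ge\lfloor d_\Lambda(v)/2\rfloor$ for all $v\in V$. *)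

(* Defs.v *)
From mathcomp Require Import all_boot.
From mathcomp Require Import finmap multiset.

Set Implicit Arguments.
Unset Strict Implicit.
Unset Printing Implicit Defensive.

Local Open Scope mset_scope.
Local Open Scope nat_scope.

Record sgraph := SGraph {
  svertex :> finType;
  adj : rel svertex;
  adj_sym : symmetric adj;
  adj_irr : irreflexive adj
}.

(* Loopless and without parallel arcs; opposite arcs u -> v -> u are allowed,
   and form a dicycle of length 2. *)
Record digraph := Digraph {
  dvertex :> finType;
  darc : rel dvertex;
  darc_irr : irreflexive darc
}.

Section Dicycles.
Variable D : digraph.
Implicit Types (T : {set D}) (u v : D) (c : seq D).

(* The empty sequence satisfies [cycle], hence its explicit exclusion. *)
Definition dicycle c : bool := [&& c != [::], cycle (@darc D) c & uniq c].

Definition arc_on_dicycle u v : Prop :=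
  exists c, [/\ dicycle c, u \in c & next c u = v].

Definition on_common_dicycle u v : Prop :=
  exists c, [/\ dicycle c, u \in c & v \in c].

Definition special_set T : Prop :=
  (forall u v, darc u v -> arc_on_dicycle u v) /\
  (forall c, dicycle c -> #|[set x in c] :&: T| = 1).

(* Adjacency after adding the chords of all dicycles and forgetting
   directions. *)
Definition chord_adj u v : Prop :=
  u != v /\ [\/ darc u v, darc v u | on_common_dicycle u v].

End Dicycles.

(* G is, up to the renaming [h] of its vertices, the graph on D - T with
   adjacency [chord_adj]. *)
Definition obtained_from (G : sgraph) (D : digraph) (T : {set D}) : Prop :=
  exists h : G -> D,
    [/\ injective h, h @: [set: G] = ~: T
      & forall x y : G, adj x y <-> chord_adj (h x) (h y)].

Definition p_comparability (p : nat) (G : sgraph) : Prop :=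
  exists (D : digraph) (T : {set D}),
    [/\ special_set T, #|T| <= p & obtained_from G T].

Section ESP.
Variable G : sgraph.

Definition clique (K : {set G}) : bool :=
  [forall x in K, forall y in K, (x != y) ==> adj x y].

Definition maxclique (K : {set G}) : bool := maxset clique K.

(* d_L(v), counted with multiplicity; L is the enumeration of a set or of a
   multiset. *)
Definition cdeg (L : seq {set G}) (v : G) : nat :=
  count (fun K : {set G} => v \in K) L.

Definition ESP : Prop :=
  forall L : {set {set G}},
    (forall K, K \in L -> maxclique K) ->
    exists L1 L2 : {mset {set G}},
      [/\ (forall K, K \in L1 -> clique K) /\ (forall K, K \in L2 -> clique K),
          size L1 + size L2 <= #|L|,
          forall v, cdeg (enum L) v <= cdeg L1 v + cdeg L2 v
        & forall v, (cdeg (enum L) v)./2 <= minn (cdeg L1 v) (cdeg L2 v)].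

End ESP.

(* Main.v *)
Require Import Defs.
From mathcomp Require Import all_boot.
From mathcomp Require Import finmap multiset zify.

Set Implicit Arguments.
Unset Strict Implicit.
Unset Printing Implicit Defensive.

(** Let [D], with special set [T], be the digraph behind [G]. Cliques of [G]
    are turned into dicycles of [D], the dicycles are halved as a circulation,
    and the two halves are turned back into cliques.

    Cliques and dicycles. The vertices outside [T] of a dicycle form a clique.
    Conversely, a clique with a vertex on some dicycle lies on one dicycle
    ([clique_on_dicycle]). A closed walk decomposes into dicycles, so it meets
    [T] at least once, and a closed walk that meets [T] exactly once is a
    dicycle ([closed_walk_special]). In particular [D - T] is acyclic, so
    reachability in [D - T] orders the vertices of a clique linearly, and there
    is a walk in [D - T] through all of them, from the first to the last. The
    first and the last vertex are adjacent, which provides a walk back that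
    meets [T] once, and the resulting closed walk is the dicycle that is sought.
    The remaining cliques are empty or consist of a vertex of [D] that is on no
    dicycle; such a vertex is in at most one member of a set of cliques, so
    these cliques can be kept unchanged.

    Halving. The sum of the chosen dicycles is a circulation, represented by the
    sequence of its arcs with multiplicity. At each vertex, list the entering
    arc ends before the leaving ones and pair consecutive ends. The pairing of
    the two ends of each arc and this pairing are two perfect matchings on the
    set of arc ends, whose union is bipartite ([involutions_bicolorable]).
    Putting an arc in the first half according to the colour of its head splits
    the arcs into two circulations that differ by at most one at each vertex
    ([halve_balanced]). Each half is a sum of dicycles
    ([balanced_decomposition]), and since a dicycle meets [T] exactly once, the
    number of dicycles in a circulation is the number of its arcs that leave
    [T]. So the halves together have as many dicycles as cliques were given. *)

(** * Bicolouring two perfect matchings *)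

(** The union of two perfect matchings, given by involutions without fixed
    points, is a disjoint union of even cycles. The proof uses the rotation
    [f = r \o t] along these cycles: [r] conjugates [f] to its inverse, so it
    permutes the orbits of [f], and it fixes none of them. Choosing one orbit in
    each pair exchanged by [r] gives the two colours. *)
Lemma involutions_bicolorable (X : finType) (r t : X -> X) :
    involutive r -> involutive t -> (forall x, r x != x) ->
    (forall x, t x != x) ->
  exists c : pred X, forall x, c (r x) = ~~ c x /\ c (t x) = ~~ c x.
Proof.
move=> rK tK rF tF; pose f := r \o t.
have injf : injective f by apply: inj_comp; apply: inv_inj.
have iter_injf k : injective (iter k f).
  by elim: k => [|k IHk] x y //= /injf /IHk.
have fr k x : iter k f (r (iter k f x)) = r x.
  elim: k x => // k IHk x; rewrite iterSr -[RHS]IHk; congr (iter k f _).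
  by rewrite iterS /f /= rK tK.
(* If [iter k f x = r x], conjugating by half of the iterations makes a
   point in the middle of the way fixed by [r] (k even) or [t] (k odd). *)
have sepr x : ~~ fconnect f x (r x).
  apply/negP => /iter_findex; move: (findex _ _ _) => k.
  rewrite -[k]odd_double_half; set j := k./2; set y := iter j f x.
  rewrite -addnn !iterD -(fr j x) -/y.
  have -> : iter (odd k) f (iter j f y) = iter j f (iter (odd k) f y).
    by case: (odd k); rewrite //= -iterSr.
  move/iter_injf; case: (odd k) => /= [/(inv_inj rK) eq_ty | eq_ry].
    by case/eqP: (tF y).
  by case/eqP: (rF y).
have symf := fconnect_sym injf.
have rootE x y : fconnect f x y -> froot f x = froot f y.
  by move=> cxy; apply/eqP; rewrite (root_connect symf).
exists (fun x => enum_rank (froot f x) < enum_rank (froot f (r x))) => x.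
have flip : (enum_rank (froot f (r x)) < enum_rank (froot f x))
  = ~~ (enum_rank (froot f x) < enum_rank (froot f (r x))).
  rewrite -leqNgt ltn_neqAle; case: eqP => // /val_inj /enum_rank_inj /eqP.
  by rewrite (root_connect symf) symf (negPf (sepr x)).
split; rewrite /= ?rK //.
have -> : froot f (t x) = froot f (r x).
  by apply: rootE; rewrite -{2}[x]tK; apply: fconnect1.
by have <- : froot f x = froot f (r (t x)) by apply: rootE; apply: fconnect1.
Qed.

(** Exchanges the items of ranks [2i] and [2i + 1], so it is an involution
    without fixed points on a duplicate-free [s] of even length. *)
Fixpoint mate (X : eqType) (s : seq X) (x : X) : X :=
  match s with
  | a :: b :: s' => if x == a then b else if x == b then a else mate s' x
  | _ => x
  end.

Lemma seq_pair_ind (X : Type) (P : seq X -> Prop) :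
    P [::] -> (forall x, P [:: x]) ->
    (forall x y s, P s -> P [:: x, y & s]) -> forall s, P s.
Proof.
move=> P0 P1 P2 s; move: {2}(size s) (leqnn (size s)) => n.
elim: n s => [|n IHn] [|x [|y s]] //= les.
by apply/P2/IHn; apply: ltnW.
Qed.

Lemma mateP (X : eqType) (s : seq X) (x : X) :
    uniq s -> ~~ odd (size s) -> x \in s ->
  [/\ mate s x \in s, mate s (mate s x) = x & mate s x != x].
Proof.
elim/seq_pair_ind: s => // a b s IHs /= /and3P[].
rewrite !inE => /norP[nab nas] nbs us; rewrite negbK => es.
have [-> _ | nxa /=] := eqVneq x a.
  by rewrite eqxx orbT eq_sym (negPf nab).
have [-> _ | nxb /= xs] := eqVneq x b.
  by rewrite !eqxx nab.
have [ms mK mF] := IHs us es xs; rewrite ms !orbT; split=> //.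
rewrite ifN; last by apply: contraNneq nas => <-.
by rewrite ifN //; apply: contraNneq nbs => <-.
Qed.

(** Pairing consecutive items makes every prefix, and not only the whole
    sequence, evenly coloured; the entering arc ends at a vertex will be such a
    prefix. *)
Lemma count_mate_prefix (X : eqType) (c : pred X) (s1 s2 : seq X) :
    uniq (s1 ++ s2) ->
    (forall x, x \in s1 ++ s2 -> c (mate (s1 ++ s2) x) = ~~ c x) ->
  (size s1)./2 <= count c s1 <= uphalf (size s1).
Proof.
elim/seq_pair_ind: s1 => [|x|a b s1 IHs] //; first by rewrite /=; case: (c x).
rewrite !cat_cons => us cm.
have cab : c a + c b = 1.
  by have := cm a (mem_head _ _); rewrite /= eqxx => ->; case: (c a).
have /andP[nas /andP[nbs us']] := us.
rewrite /= addnA cab add1n ltnS; apply: IHs => // x xs; rewrite -cm /=.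
  rewrite ifN ?ifN //; first by apply: contraNneq nbs => <-.
  by apply: contraNneq nas => <-; rewrite inE xs orbT.
by rewrite !inE xs !orbT.
Qed.

(** * Halving a circulation *)

(** A balanced directed multigraph with arc set [E] splits into two balanced
    parts of almost equal degrees. An arc is in [S] when its head end is
    coloured. Half of the arc ends at [v] are coloured, and the two ends of an
    arc have opposite colours, so [v] has as many leaving as entering arcs in
    [S]. *)
Lemma halve_balanced (V E : finType) (tail head : E -> V) :
    (forall v, #|[pred e | tail e == v]| = #|[pred e | head e == v]|) ->
  exists S : pred E, forall v,
    #|[pred e in S | tail e == v]| = #|[pred e in S | head e == v]| /\
    #|[pred e | tail e == v]|./2 <= #|[pred e in S | tail e == v]|
      <= uphalf #|[pred e | tail e == v]|.
Proof.
move=> bal.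
(* [(e, true)] is the head end of [e] and [(e, false)] its tail end. *)
pose foot (x : E * bool) := if x.2 then head x.1 else tail x.1.
pose ends v b := [seq (e, b) | e <- enum [pred e | foot (e, b) == v]].
pose half_edges v := ends v true ++ ends v false.
have size_ends v b : size (ends v b) = #|[pred e | foot (e, b) == v]|.
  by rewrite size_map -cardE.
have half_edgesP x v : (x \in half_edges v) = (foot x == v).
  case: x => e b; rewrite mem_cat.
  have memE b' : ((e, b) \in ends v b') = (b == b') && (foot (e, b) == v).
    apply/mapP/idP => [[e'] | /andP[/eqP <- fe]].
      by rewrite mem_enum inE => fe [-> ->]; rewrite eqxx.
    by exists e; rewrite ?mem_enum.
  by rewrite !memE; case: (b); rewrite ?orbF.
have uniq_half v : uniq (half_edges v).
  rewrite cat_uniq !map_inj_uniq ?enum_uniq ?andbT => [|? ? [] //|? ? [] //].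
  by apply/hasPn => _ /mapP[e _ ->]; apply/negP => /mapP[e' _].
have size_half v : size (half_edges v) = #|[pred e | tail e == v]|.*2.
  by rewrite size_cat !size_ends -addnn bal.
have even_half v : ~~ odd (size (half_edges v)).
  by rewrite size_half odd_double.
pose t x := mate (half_edges (foot x)) x.
have tP x : [/\ foot (t x) = foot x, t (t x) = x & t x != x].
  have := mateP (uniq_half (foot x)) (even_half _) (x := x).
  rewrite half_edgesP eqxx => /(_ isT)[].
  rewrite half_edgesP => /eqP; rewrite -/(t x) => ft tK tF.
  by split; rewrite // /t ft.
pose r (x : E * bool) := (x.1, ~~ x.2).
have [||||c cP] := @involutions_bicolorable _ r t.
- by case=> e b; rewrite /r /= negbK.
- by move=> x; case: (tP x).
- by case=> e b; rewrite /r xpair_eqE /= eqxx; case: b.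
- by move=> x; case: (tP x).
have cE v x : x \in half_edges v -> c (mate (half_edges v) x) = ~~ c x.
  by rewrite half_edgesP => /eqP <-; case: (cP x).
exists (fun e => c (e, true)) => v.
have cntT : count c (ends v true)
    = #|[pred e in (fun e => c (e, true)) | head e == v]|.
  rewrite count_map -size_filter cardE; congr (size _).
  by rewrite -filter_predI; apply: eq_filter => e.
have cntF : count c (ends v false)
    + #|[pred e in (fun e => c (e, true)) | tail e == v]|
    = #|[pred e | tail e == v]|.
  rewrite -[RHS](size_ends v false) -(count_predC c); congr addn.
  rewrite count_map -size_filter cardE; congr (size _).
  rewrite -filter_predI; apply: eq_filter => e /=.
  rewrite !inE; congr andb.
  by have [<- _] := cP (e, false).
have := @count_mate_prefix _ c (ends v true) (ends v false)
  (uniq_half v) (cE v).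
have := @count_mate_prefix _ c (half_edges v) [::].
rewrite cats0 => /(_ (uniq_half v) (cE v)).
rewrite size_half doubleK uphalf_double -eqn_leq count_cat cntT.
have -> : size (ends v true) = #|[pred e | tail e == v]|.
  by rewrite size_ends bal.
move=> /eqP tot bnd.
have eqS : #|[pred e in (fun e => c (e, true)) | tail e == v]|
    = #|[pred e in (fun e => c (e, true)) | head e == v]|.
  by apply: (@addnI (count c (ends v false))); rewrite cntF tot addnC.
by rewrite eqS.
Qed.

Lemma half_split (n m k : nat) :
  m + k = n -> n./2 <= m <= uphalf n -> n./2 <= minn m k.
Proof. by move=> <-; rewrite leq_min; lia. Qed.

(** A circulation is a sequence of arcs whose tails and heads agree up to
    order. *)
Lemma halve_arcs (V : finType) (A : seq (V * V)) :
    perm_eq (unzip1 A) (unzip2 A) ->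
  exists A1 A2, [/\ perm_eq (A1 ++ A2) A,
    perm_eq (unzip1 A1) (unzip2 A1), perm_eq (unzip1 A2) (unzip2 A2)
    & forall v, (count_mem v (unzip1 A))./2
        <= minn (count_mem v (unzip1 A1)) (count_mem v (unzip1 A2))].
Proof.
move=> balA; pose a := tnth (in_tuple A).
have cardA (P : pred ('I_(size A))) (f : V * V -> V) v :
    #|[pred i in P | f (a i) == v]|
    = count_mem v (map f (map a (filter P (enum 'I_(size A))))).
  rewrite -map_comp count_map count_filter cardE -size_filter -filter_predI.
  by congr size; apply: eq_filter => i; rewrite /= !inE andbT andbC.
have mapA : map a (enum 'I_(size A)) = A by apply: map_tnth_enum.
have cardAT (f : V * V -> V) v :
    #|[pred i | f (a i) == v]| = count_mem v (map f A).
  by rewrite -[in RHS]mapA -[enum _ in RHS]filter_predT -cardA.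
have [|S SP] := @halve_balanced V _ (fst \o a) (snd \o a).
  by move=> v; rewrite (cardAT fst) (cardAT snd); apply: (permP balA).
pose A1 := map a (filter S (enum 'I_(size A))).
pose A2 := map a (filter (predC S) (enum 'I_(size A))).
have permA : perm_eq (A1 ++ A2) A.
  by rewrite -[in X in perm_eq _ X]mapA -map_cat perm_map // perm_filterC.
have balA1 : perm_eq (unzip1 A1) (unzip2 A1).
  apply/allP => v _ /=; rewrite -(cardA S fst) -(cardA S snd).
  by case: (SP v) => ->.
exists A1, A2; split=> // [|v].
  apply/permP => P; move: (permP balA P) (permP balA1 P).
  have := permP (perm_map fst permA) P; have := permP (perm_map snd permA) P.
  by rewrite !map_cat !count_cat /unzip1 /unzip2 => <- <- eqA /eqP;
    rewrite -(eqn_add2r (count P (map fst A2))) eqA eqn_add2l => /eqP.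
have [_] := SP v; rewrite (cardAT fst) (cardA S fst) -/A1.
have := permP (perm_map fst permA) (pred1 v); rewrite map_cat count_cat.
exact: half_split.
Qed.

(** * Decomposing a circulation into dicycles *)

(** Following chosen out-neighbours inside [S] must loop; the loop is the part
    of the orbit from the first revisited vertex on. *)
Lemma total_digraph_cycle (V : finType) (e : rel V) (S : {pred V}) x0 :
    x0 \in S -> (forall x, x \in S -> exists2 y, e x y & y \in S) ->
  exists c, [/\ c != [::], cycle e c & uniq c].
Proof.
move=> x0S next_ex.
pose f x := odflt x [pick y | e x y && (y \in S)].
have fP x : x \in S -> e x (f x) /\ f x \in S.
  rewrite /f => /next_ex[y exy yS]; case: pickP => [z /andP[] //|/(_ y)].
  by rewrite exy yS.
have iter_in n x : x \in S -> iter n f x \in S.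
  by move=> xS; elim: n => //= n IHn; case: (fP _ IHn).
have path_traject n x : x \in S -> path e x (traject f (f x) n).
  by elim: n x => //= n IHn x /fP[-> /IHn ->].
have [i lt_i eq_i] := trajectP (looping_order f x0).
pose c := traject f (iter i f x0) (order f x0 - i).
have drop_c : c = drop i (orbit f x0).
  rewrite /c /orbit -{2}(subnKC (ltnW lt_i)) trajectD.
  by rewrite drop_size_cat // size_traject.
exists c; rewrite {3}drop_c drop_uniq ?orbit_uniq //; split=> //.
  by rewrite -size_eq0 size_traject subn_eq0 -ltnNge.
rewrite /c; case def_m: (order f x0 - i) => [|m] //=.
have closes : f (iter m f (iter i f x0)) = iter i f x0.
  by rewrite -iterS -def_m -iterD subnK // ltnW.
rewrite rcons_path last_traject path_traject ?iter_in //= -{2}closes.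
by case: (fP (iter m f (iter i f x0))); rewrite ?iter_in.
Qed.

Definition cycle_arcs (V : eqType) (c : seq V) : seq (V * V) :=
  [seq (x, next c x) | x <- c].

Lemma heads_cycle_arcs (V : eqType) (c : seq V) : unzip1 (cycle_arcs c) = c.
Proof. by rewrite /unzip1 -map_comp map_id. Qed.

Lemma cycle_arcs_balanced (V : eqType) (c : seq V) :
  uniq c -> perm_eq (unzip1 (cycle_arcs c)) (unzip2 (cycle_arcs c)).
Proof.
move=> uc; rewrite heads_cycle_arcs /unzip2 -map_comp perm_sym.
have inj_next : injective (next c) by apply: can_inj (prev_next uc).
apply: uniq_perm => //; first by rewrite map_inj_uniq.
move=> x; apply/mapP/idP => [[y yc ->] | xc]; first by rewrite /= mem_next.
by exists (prev c x); rewrite ?mem_prev //= next_prev.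
Qed.

Lemma uniq_sub_complement (V : eqType) (s t : seq V) :
  uniq s -> {subset s <= t} -> exists r, perm_eq (s ++ r) t.
Proof.
elim: s t => [|x s IHs] t /=; first by exists t.
move=> /andP[nxs us] sub_st; have xt := sub_st x (mem_head _ _).
have [|r perm_r] := IHs (rem x t) us.
  move=> y ys; apply: rem_mem; first by apply: contraNneq nxs => <-.
  by apply: sub_st; rewrite inE ys orbT.
by exists r; rewrite (permPr (perm_to_rem xt)) perm_cons.
Qed.

(** A nonempty circulation contains a dicycle, because every head of an arc is
    the tail of another one, and removing it leaves a smaller circulation. *)
Lemma balanced_decomposition (D : digraph) (A : seq (D * D)) :
    {in A, forall a, darc a.1 a.2} -> perm_eq (unzip1 A) (unzip2 A) ->
  exists2 cs : seq (seq D), all (@dicycle D) cs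
    & perm_eq (flatten cs) (unzip1 A).
Proof.
have [n] := ubnP (size A); elim: n A => // n IHn A leAn arcA balA.
have [-> | [a0 a0A]] : A = [::] \/ exists a, a \in A.
- by case: (A) => [|a A']; [left | right; exists a; rewrite mem_head].
- by exists [::].
have [|x /mapP[a aA ->] |c [c0 cyc uc]] :=
    @total_digraph_cycle D (fun x y => (x, y) \in A) (mem (unzip1 A)) a0.1.
- exact: map_f.
- exists a.2; first by case: (a) aA.
  by rewrite /= (perm_mem balA) map_f.
have uarcs : uniq (cycle_arcs c) by rewrite map_inj_uniq // => x y [].
have subA : {subset cycle_arcs c <= A}.
  by move=> _ /mapP[x xc ->]; apply: (next_cycle cyc).
have [B permB] := uniq_sub_complement uarcs subA.
have [|||cs dcs permcs] := IHn B.
- move: leAn; rewrite -(perm_size permB) size_cat size_map.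
  by case: (c) c0 => //= *; lia.
- by move=> a aB; apply: arcA; rewrite -(perm_mem permB) mem_cat aB orbT.
- rewrite -(perm_cat2l (unzip1 (cycle_arcs c))).
  apply/permP => P; have := permP balA P.
  have := permP (perm_map fst permB) P; have := permP (perm_map snd permB) P.
  rewrite !map_cat !count_cat (permP (cycle_arcs_balanced uc)).
  by rewrite /unzip1 /unzip2 => -> -> ->.
exists (c :: cs); rewrite /= ?dcs ?andbT.
  apply/and3P; split=> //; apply: sub_cycle cyc => x y.
  by move/arcA.
rewrite -(permPr (perm_map fst permB)) map_cat -/(unzip1 _) heads_cycle_arcs.
by rewrite perm_cat2l.
Qed.

(** This makes the number of dicycles in a decomposition depend only on the
    circulation. *)
Lemma size_dicycles (D : digraph) (T : {set D}) (cs : seq (seq D)) :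
    special_set T -> all (@dicycle D) cs ->
  count (mem T) (flatten cs) = size cs.
Proof.
case=> _ onceT; elim: cs => //= c cs IHcs /andP[dc dcs].
have /and3P[_ _ uc] := dc.
rewrite count_cat IHcs // -add1n -(onceT c dc) -size_filter; congr addn.
rewrite -(card_uniqP (filter_uniq _ uc)); apply: eq_card => x.
by rewrite !inE mem_filter andbC.
Qed.

Lemma count_mem_flatten (V : eqType) (cs : seq (seq V)) v :
  all uniq cs -> count_mem v (flatten cs) = count (fun c => v \in c) cs.
Proof.
elim: cs => //= c cs IHcs /andP[uc ucs].
by rewrite count_cat count_uniq_mem // IHcs.
Qed.

(** The dicycles of the two families need not occur in [cs]: only the degrees
    and the total number are kept. *)
Lemma halve_dicycles (D : digraph) (T : {set D}) (cs : seq (seq D)) :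
    special_set T -> all (@dicycle D) cs ->
  exists cs1 cs2 : seq (seq D), [/\ all (@dicycle D) cs1, all (@dicycle D) cs2,
    size cs1 + size cs2 = size cs
    & forall v, let d cs := count (fun c => v \in c) cs in
        d cs = d cs1 + d cs2 /\ (d cs)./2 <= minn (d cs1) (d cs2)].
Proof.
move=> spT dcs.
have all_uniq cs' : all (@dicycle D) cs' -> all uniq cs'.
  by apply: sub_all => c /and3P[].
pose A := flatten (map (@cycle_arcs D) cs).
have tailsA : unzip1 A = flatten cs.
  rewrite /unzip1 map_flatten -map_comp -[in RHS](map_id cs).
  by congr flatten; apply: eq_map => c; apply: heads_cycle_arcs.
have balA : perm_eq (unzip1 A) (unzip2 A).
  rewrite {tailsA}/A.
  elim: (cs) dcs => //= c cs' IHcs /andP[/and3P[_ _ uc] dcs'].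
  by rewrite /unzip1 /unzip2 !map_cat perm_cat ?IHcs ?cycle_arcs_balanced.
have arcA : {in A, forall a, darc a.1 a.2}.
  move=> a /flatten_mapP[c ccs /mapP[x xc ->]] /=.
  by have /and3P[_ cyc _] := allP dcs _ ccs; apply: next_cycle.
have [A1 [A2 [permA bal1 bal2 halfA]]] := halve_arcs balA.
have [a aA1|cs1 dcs1 perm1] := balanced_decomposition _ bal1.
  by apply: arcA; rewrite -(perm_mem permA) mem_cat aA1.
have [a aA2|cs2 dcs2 perm2] := balanced_decomposition _ bal2.
  by apply: arcA; rewrite -(perm_mem permA) mem_cat aA2 orbT.
have perm_cs : perm_eq (flatten cs1 ++ flatten cs2) (flatten cs).
  rewrite -tailsA -(permPr (perm_map fst permA)) map_cat.
  exact: perm_cat.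
exists cs1, cs2; split=> // [|v].
  rewrite -(size_dicycles spT dcs1) -(size_dicycles spT dcs2).
  by rewrite -(size_dicycles spT dcs) -count_cat (permP perm_cs).
rewrite /= -!count_mem_flatten ?all_uniq //.
rewrite -count_cat (permP perm_cs) (permP perm1) (permP perm2); split=> //.
by rewrite -tailsA; apply: halfA.
Qed.

(** * Every clique lies on a dicycle *)

Lemma not_uniq_split (V : eqType) (c : seq V) :
  ~~ uniq c -> exists x p q r, c = p ++ x :: q ++ x :: r.
Proof.
elim: c => //= y c IHc; case: (boolP (y \in c)) => [yc _ | _ /= /IHc].
  by case/splitPr: yc => q r; exists y, [::], q, r.
by move=> [x [p [q [r ->]]]]; exists x, (y :: p), q, r.
Qed.

(** A closed walk that repeats a vertex is cut there into two shorter closed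
    walks, each of which meets [T]. *)
Lemma closed_walk_special (D : digraph) (T : {set D}) (c : seq D) :
    special_set T -> c != [::] -> cycle (@darc D) c ->
  0 < count (mem T) c /\ (count (mem T) c = 1 -> uniq c).
Proof.
move=> spT; have [n] := ubnP (size c); elim: n c => // n IHn c lecn c0 cyc.
have [uc | /not_uniq_split[x [p [q [r def_c]]]]] := boolP (uniq c).
  have dc : all (@dicycle D) [:: c] by rewrite /= /dicycle c0 cyc uc.
  by have := size_dicycles spT dc; rewrite /= cats0 => ->.
have cyc_rot : cycle (@darc D) ((x :: q) ++ (x :: r ++ p)).
  by move: cyc; rewrite def_c -(rot_cycle (size p)) rot_size_cat /= -catA.
have /andP[cycq cycr] :
    cycle (@darc D) (x :: q) && cycle (@darc D) (x :: r ++ p).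
  move: cyc_rot; rewrite cat_cons /= rcons_cat rcons_cons cat_path /=.
  by rewrite !rcons_path andbA.
have count_c :
    count (mem T) c = count (mem T) (x :: q) + count (mem T) (x :: r ++ p).
  rewrite def_c /= !count_cat /= !count_cat /=; lia.
have size_c : size c = size (x :: q) + size (x :: r ++ p).
  rewrite def_c /= !size_cat /= !size_cat /=; lia.
have [|//|//|q0 _] := IHn (x :: q).
  by move: lecn; rewrite size_c /=; lia.
have [|//|//|r0 _] := IHn (x :: r ++ p).
  by move: lecn; rewrite size_c /=; lia.
by rewrite count_c; split=> [|eq1]; lia.
Qed.

Lemma connect_path_through (V : finType) (e : rel V) (x : V) (s : seq V) :
    path (connect e) x s ->
  exists p, [/\ path e x p, last x p = last x s & {subset s <= x :: p}].
Proof.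
elim: s x => [|y s IHs] x /=; first by exists [::].
case/andP=> /connectP[p1 p1P def_y] /IHs[p2 [p2P lastp sub_p]].
exists (p1 ++ p2); rewrite cat_path p1P last_cat -def_y p2P lastp; split=> // z.
have p1_sub w : w \in x :: p1 -> w \in x :: p1 ++ p2.
  by rewrite -cat_cons mem_cat => ->.
have y_in : y \in x :: p1 ++ p2 by apply: p1_sub; rewrite def_y mem_last.
rewrite inE => /predU1P[-> // | /sub_p]; rewrite inE => /predU1P[-> // | zp2].
by rewrite -cat_cons mem_cat zp2 orbT.
Qed.

(** The condition bears on the end of the arc only, so that a path counts the
    visits to [T] after its starting point, and counts add up under
    concatenation. *)
Definition arc_off (D : digraph) (T : {set D}) : rel D :=
  [rel u v | darc u v && (v \notin T)].

Lemma path_arc_off (D : digraph) (T : {set D}) (x : D) (p : seq D) :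
  path (arc_off T) x p = path (@darc D) x p && (count (mem T) p == 0).
Proof.
elim: p x => //= y p IHp x; rewrite IHp -!andbA.
by case: (darc x y) => //=; case: (y \in T); rewrite /= ?andbF.
Qed.

Definition returns (D : digraph) (T : {set D}) (x y : D) : Prop :=
  exists q, [/\ path (@darc D) x q, last x q = y & count (mem T) q = 1].

(** [x] and [y] cut a common dicycle into two paths, and [T] meets only one of
    them. *)
Lemma common_dicycle_returns (D : digraph) (T : {set D}) (x y : D) :
    special_set T -> x \notin T -> y \notin T -> x != y ->
    on_common_dicycle x y ->
  (connect (arc_off T) x y /\ returns T y x) \/
  (connect (arc_off T) y x /\ returns T x y).
Proof.
move=> spT xT yT nxy [c [dc xc yc]].
have count_c : count (mem T) c = 1.
  have dcs : all (@dicycle D) [:: c] by rewrite /= dc.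
  by have := size_dicycles spT dcs; rewrite /= cats0.
have /and3P[_ cyc _] := dc.
have [i s def_s] := rot_to xc.
have ys : y \in s.
  by have := mem_rot i c y; rewrite def_s inE yc eq_sym (negPf nxy).
case/splitPr: ys def_s => p q def_s.
have /andP[pathp pathq] :
    path (@darc D) x (rcons p y) && path (@darc D) y (rcons q x).
  move: cyc; rewrite -(rot_cycle i) def_s /= rcons_cat /= cat_path /=.
  by rewrite !rcons_path -!andbA.
have {}count_c : count (mem T) p + count (mem T) q = 1.
  have /permP/(_ (mem T)) : perm_eq (rot i c) c by rewrite perm_rot.
  rewrite def_s count_c /=.
  by rewrite count_cat /= (negPf xT) (negPf yT).
have half u v r : path (@darc D) u (rcons r v) -> v \notin T ->
    (count (mem T) r = 0 -> connect (arc_off T) u v) /\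
    (count (mem T) r = 1 -> returns T u v).
  move=> pathr vT; have cnt : count (mem T) (rcons r v) = count (mem T) r.
    by rewrite -cats1 count_cat /= (negPf vT) !addn0.
  split=> cr.
    apply/connectP; exists (rcons r v); rewrite ?last_rcons //.
    by rewrite path_arc_off pathr cnt cr.
  by exists (rcons r v); rewrite last_rcons cnt.
have [p0 p1] := half _ _ _ pathp yT; have [q0 q1] := half _ _ _ pathq xT.
case def_p: (count (mem T) p) count_c => [|m] count_c.
  by left; split; [apply: p0 | apply: q1].
by right; split; [apply: q0; lia | apply: p1; lia].
Qed.

(** Taking [x = y] in the hypothesis ensures that a singleton [K] is on a
    dicycle. *)
Lemma clique_on_dicycle (D : digraph) (T K : {set D}) :
    special_set T -> [disjoint K & T] -> K != set0 ->
    (forall x y, x \in K -> y \in K -> on_common_dicycle x y) ->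
  exists2 c, dicycle c & {subset K <= c}.
Proof.
move=> spT disKT K0 adjK.
have offT x : x \in K -> x \notin T by move/(disjointFr disKT)=> ->.
have total_K : {in K &, total (connect (arc_off T))}.
  move=> x y xK yK; have [-> | nxy] := eqVneq x y; first by rewrite connect0.
  case: (common_dicycle_returns spT (offT x xK) (offT y yK) nxy
    (adjK x y xK yK)).
    by case=> ->.
  by case=> ->; rewrite orbT.
have allK : all (mem K) (enum K) by apply/allP => x; rewrite mem_enum.
have := sort_sorted_in total_K allK.
have mem_s : sort (connect (arc_off T)) (enum K) =i K.
  by move=> x; rewrite mem_sort mem_enum.
case def_s: (sort _ _) mem_s => [|x s] mem_s /=.
  by case/set0Pn: K0 => x; rewrite -mem_s.
case/connect_path_through=> p [pathp lastp sub_p].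
have sub_K z : z \in K -> z \in x :: p.
  by rewrite -mem_s inE => /predU1P[-> | /sub_p //]; rewrite mem_head.
have xK : x \in K by rewrite -mem_s mem_head.
have zK : last x p \in K by rewrite lastp -mem_s mem_last.
move: pathp; rewrite path_arc_off => /andP[pathp /eqP count_p].
have closed q : path (@darc D) (last x p) q -> last (last x p) q = x ->
    cycle (@darc D) (p ++ q).
  by move=> pathq lastq; rewrite (cycle_path x) last_cat lastq cat_path pathp.
(* A walk that avoids [T] cannot be closed unless it is trivial. *)
have [eq_xz | nxz] := eqVneq x (last x p).
  have [def_p | p0] := eqVneq p [::].
    have [c [dc xc _]] := adjK x x xK xK; exists c => // z /sub_K.
    by rewrite def_p inE => /eqP ->.
  have cyc : cycle (@darc D) p by have := closed [::]; rewrite cats0; apply.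
  by have [] := closed_walk_special spT p0 cyc; rewrite count_p.
have nz_pq q : p ++ q != [::].
  by apply: contraNneq nxz; case: (p).
case: (common_dicycle_returns spT (offT _ xK) (offT _ zK) nxz (adjK _ _ xK zK)).
  case=> _ [q [pathq lastq count_q]]; have cyc := closed q pathq lastq.
  have [_ uniq_pq] := closed_walk_special spT (nz_pq q) cyc.
  exists (p ++ q) => [|w /sub_K].
    by rewrite /dicycle nz_pq cyc uniq_pq // count_cat count_p count_q.
  rewrite inE mem_cat => /predU1P[-> | -> //].
  have := mem_last (last x p) q; rewrite lastq inE (negPf nxz) /= => ->.
  by rewrite orbT.
case=> /connectP[q]; rewrite path_arc_off => /andP[pathq /eqP count_q] lastq _.
have cyc := closed q pathq (esym lastq).
have [] := closed_walk_special spT (nz_pq q) cyc.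
by rewrite count_cat count_p count_q.
Qed.

(** * From dicycles to cliques and back *)

(** Since every arc is on a dicycle, this is a decidable form of being on no
    dicycle. *)
Definition no_arc_into (D : digraph) (v : D) : bool := [forall u, ~~ darc u v].

Lemma dicycle_arc_into (D : digraph) (c : seq D) (v : D) :
  dicycle c -> v \in c -> ~~ no_arc_into v.
Proof.
case/and3P=> _ cyc _ vc; rewrite negb_forall; apply/existsP; exists (prev c v).
by rewrite negbK prev_cycle.
Qed.

Lemma arc_common_dicycle (D : digraph) (T : {set D}) (u v : D) :
  special_set T -> darc u v -> on_common_dicycle u v.
Proof.
case=> arcT _ /arcT[c [dc uc <-]]; exists c; split=> //; by rewrite mem_next.
Qed.

Lemma on_common_dicycle_sym (D : digraph) (u v : D) :
  on_common_dicycle u v -> on_common_dicycle v u.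
Proof. by case=> c [dc uc vc]; exists c. Qed.

Lemma chord_adj_common_dicycle (D : digraph) (T : {set D}) (u v : D) :
  special_set T -> chord_adj u v -> on_common_dicycle u v.
Proof.
move=> spT [_ [uv | vu | //]]; first exact: arc_common_dicycle spT uv.
exact/on_common_dicycle_sym/(arc_common_dicycle spT vu).
Qed.

Lemma cliqueP (G : sgraph) (K : {set G}) :
  reflect {in K &, forall x y, x != y -> adj x y} (clique K).
Proof.
apply: (iffP forall_inP) => [cliK x y xK yK | cliK x xK].
  by have /forall_inP/(_ y yK)/implyP := cliK x xK.
by apply/forall_inP => y yK; apply/implyP; apply: cliK.
Qed.

Lemma cdeg_seq_mset (G : sgraph) (s : seq {set G}) (v : G) :
  cdeg (seq_mset s) v = cdeg s v.
Proof. exact: (permP (perm_eq_seq_mset s)). Qed.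

Definition vertices_on (G : sgraph) (D : digraph) (h : G -> D) (c : seq D) :
    {set G} :=
  [set x | h x \in c].

Lemma vertices_on_clique (G : sgraph) (D : digraph) (h : G -> D) (c : seq D) :
    injective h -> (forall x y : G, adj x y <-> chord_adj (h x) (h y)) ->
  dicycle c -> clique (vertices_on h c).
Proof.
move=> injh adjh dc; apply/cliqueP => x y; rewrite !inE => xc yc nxy.
apply/adjh; split; first by rewrite inj_eq.
by apply: Or33; exists c.
Qed.

Lemma cdeg_vertices_on (G : sgraph) (D : digraph) (h : G -> D)
    (cs : seq (seq D)) (v : G) :
  cdeg (map (vertices_on h) cs) v = count (fun c => h v \in c) cs.
Proof. by rewrite /cdeg count_map; apply: eq_count => c; rewrite /= inE. Qed.

Theorem theorem4p3 (p : nat) (G : sgraph) : p_comparability p G -> ESP G.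
Proof.
case=> D [T [spT _ [h [injh imh adjh]]]] L maxL.
have cliqueL K : K \in enum L -> clique K.
  by rewrite mem_enum => /maxL/maxsetp.
have adj_common x y : adj x y -> on_common_dicycle (h x) (h y).
  by move/adjh; apply: (chord_adj_common_dicycle spT).
have adj_arc_into x y : adj x y -> ~~ no_arc_into (h x).
  by case/adj_common=> c [dc xc _]; apply: dicycle_arc_into dc xc.
(* The cliques that need not lie on a dicycle; being cliques, they have at
   most one vertex. *)
pose bad (K : {set G}) := [forall v in K, no_arc_into (h v)].
have good_on_dicycle K : clique K -> ~~ bad K ->
    exists2 c, dicycle c & {subset K <= vertices_on h c}.
  move=> /cliqueP cliK; rewrite negb_forall => /existsP[v].
  rewrite negb_imply negb_forall => /andP[vK /existsP[u]]; rewrite negbK => uv.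
  have vv : on_common_dicycle (h v) (h v).
    by case: (arc_common_dicycle spT uv) => c [dc _ vc]; exists c.
  have [|||c dc subc] := @clique_on_dicycle D T (h @: K) spT.
  - rewrite -setI_eq0 -subset0 -(setICr T) setIC setIS // -imh.
    by apply: imsetS; apply: subsetT.
  - by apply/set0Pn; exists (h v); apply: imset_f.
  - move=> _ _ /imsetP[x xK ->] /imsetP[y yK ->].
    have [<- | nxy] := eqVneq x y; last by apply/adj_common/cliK.
    have [-> // | nxv] := eqVneq x v.
    by have [c [dc xc _]] := adj_common _ _ (cliK x v xK vK nxv); exists c.
  by exists c => // x xK; rewrite inE; apply/subc/imset_f.
have [cs [dcs size_cs le_cs]] : exists cs, [/\ all (@dicycle D) cs,
    size cs = size (filter (predC bad) (enum L))
    & forall v, cdeg (filter (predC bad) (enum L)) v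
        <= count (fun c => h v \in c) cs].
  elim: (enum L) cliqueL => [|K Ls IHL] cliqueL /=; first by exists [::].
  have [|cs [dcs size_cs le_cs]] := IHL.
    by move=> M ML; apply: cliqueL; rewrite inE ML orbT.
  have [_ | nbK] /= := boolP (bad K); first by exists cs.
  have [c dc subc] := good_on_dicycle K (cliqueL K (mem_head _ _)) nbK.
  exists (c :: cs); rewrite /= dc size_cs; split=> // v.
  apply: leq_add (le_cs v); case vK: (v \in K) => //.
  by have := subc v vK; rewrite inE => ->.
(* Here it matters that [L] is a set and not a multiset. *)
have bad_deg v : 0 < cdeg (filter bad (enum L)) v ->
    cdeg (enum L) v <= 1.
  rewrite -has_count => /hasP[K]; rewrite mem_filter => /andP[badK KL] vK.
  have no_arc_v : no_arc_into (h v) by apply: (forall_inP badK).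
  have singleL M : M \in enum L -> v \in M -> M = [set v].
    move=> /cliqueL/cliqueP cliM vM; apply/setP => u; rewrite inE.
    apply/idP/eqP => [uM | -> //]; apply: contraTeq no_arc_v => nuv.
    by apply: (adj_arc_into _ u); apply: cliM; rewrite // eq_sym.
  have memE : {in enum L, (fun M : {set G} => v \in M) =1 pred1 [set v]}.
    move=> M ML /=; apply/idP/eqP => [/(singleL M ML) // | ->].
    by rewrite set11.
  by rewrite /cdeg (eq_in_count memE) count_uniq_mem ?enum_uniq ?leq_b1.
have [cs1 [cs2 [dcs1 dcs2 size12 halves]]] := halve_dicycles spT dcs.
pose L1 := map (vertices_on h) cs1 ++ filter bad (enum L).
pose L2 := map (vertices_on h) cs2.
have vertices_on_cliques cs' : all (@dicycle D) cs' ->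
    forall K, K \in map (vertices_on h) cs' -> clique K.
  move=> dcs' _ /mapP[c /(allP dcs') dc ->].
  exact: (vertices_on_clique injh adjh dc).
have split_deg v : cdeg (enum L) v
    = cdeg (filter bad (enum L)) v + cdeg (filter (predC bad) (enum L)) v.
  by rewrite /cdeg -count_cat (permP (permEl (perm_filterC bad (enum L)))).
exists (seq_mset L1), (seq_mset L2); split.
- split=> K; rewrite (perm_mem (perm_eq_seq_mset _)).
    rewrite mem_cat => /orP[/(vertices_on_cliques _ dcs1) // |].
    by rewrite mem_filter => /andP[_ /cliqueL].
  exact: vertices_on_cliques.
- rewrite !(perm_size (perm_eq_seq_mset _)) size_cat !size_map addnAC size12.
  by rewrite size_cs !size_filter addnC count_predC -cardE.
- move=> v; rewrite !cdeg_seq_mset /cdeg count_cat -/(cdeg _ v) -/(cdeg _ v).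
  rewrite -/(cdeg _ v) -/(cdeg _ v) !cdeg_vertices_on split_deg.
  rewrite addnAC addnC leq_add2r.
  by have [<- _] := halves (h v); apply: le_cs.
- move=> v; rewrite !cdeg_seq_mset /cdeg count_cat -/(cdeg _ v) -/(cdeg _ v).
  rewrite -/(cdeg _ v) -/(cdeg _ v) !cdeg_vertices_on.
  have [_ le_half] := halves (h v).
  have [b0 | /bad_deg d1] := posnP (cdeg (filter bad (enum L)) v).
    rewrite split_deg b0 addn0; apply: leq_trans le_half.
    exact/half_leq/le_cs.
  by case: (cdeg _ v) d1 => [|[|d]].
Qed.
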